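(* Let $X$ be a real topological-linear space, $Y$ a real locally convex space, $\Omega\subseteq X$ nonempty, $f:X\to Y$, and $K\subseteq Y$ a nontrivial cone. Let $\bar x\in\mathrm{PEff}_{He}(\Omega\mid f,K)$, i.e., there is $D\in\mathcal D(K)$ such that $\bar x\in\mathrm{Eff}(\Omega\mid f,D)$. Define $\bar D:=Y\setminus(-\operatorname{int}D)$. Assume that $B_K(\psi)$ and $B_{\bar D}(\psi)$ are normlike-bases for $K$ and $\bar D$, respectively, constructed with respect to a continuous seminorm $\psi:Y\to\mathbb R$. Suppose that $\operatorname{cl}S_{-K}(\psi)$ is compact, and $$(\operatorname{cl}S^0_{\bar D}(\psi))\cap(\operatorname{cl}S_{-K}(\psi))=\emptyset.$$ Then there exists $(x^*,\alpha)\in K^{a\#}(\psi)\cap(Y^*\times\mathbb P)$ such that, with $C:=C_\psi(x^*,\alpha)$, $\bar x\in\mathrm{WEff}(\Omega\mid f,C)$. Moreover, if $\operatorname{int}C\ne\emptyset$ and $\varphi:Y\to\mathbb R$ is a sublinear functional with $\varphi(0)=0$ which is $-C$ representing, then: (i) for any $k\in\operatorname{int}C$, $(\bar x,0)$ is a solution of $(P_\varphi^{a,k})$ for $a=f(\bar x)$; (ii) if $\varphi$ is strictly $-C$ representing (e.g. if $\varphi=\varphi_{x^*,\alpha}$ and $C^>_\psi(x^*,\alpha)\neq\emptyset$), then $\bar x\in\operatorname{argmin}_{x\in\Omega}\varphi(f(x)-f(\bar x))$; (iii) if $\mathcal P\subseteq Y$, $\mathcal T\subseteq\operatorname{int}C$,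 $\mathcal R\subseteq\mathbb R$ satisfy $f[\mathrm{WEff}(\Omega\mid f,C)]\subseteq\mathcal P+\mathcal R\cdot\mathcal T$, then there are $a\in\mathcal P$, $k\in\mathcal T$, $s\in\mathcal R$ so that $(\bar x,s)$ is a solution of $(P_\varphi^{a,k})$; (iv) if, in addition to the assumption in (iii), $C$ is closed and nontrivial, then there are $a\in\mathcal P$, $k\in\mathcal T$, $s\in\mathcal R$ so that $s=\varphi^G_{a-C,k}(f(\bar x))=\min_{x\in\Omega}\varphi^G_{a-C,k}(f(x))$.
   Context: $Y^*$ is the topological dual of $Y$, $\mathbb R_+=[0,\infty)$, $\mathbb P=(0,\infty)$. A set $K\subseteq Y$ is a cone if $0\in K=\mathbb R_+\cdot K$ (not necessarily convex); it is nontrivial if $\{0\}\ne K\ne Y$. $\mathcal D(K)$ is the family of all nontrivial, convex cones $D\subseteq Y$ with $K\setminus\{0\}\subseteq\operatorname{int}D$. $\mathrm{Eff}(\Omega\mid f,C)$ is the set of $\bar x\in\Omega$ for which there is no $x\in\Omega$ with $f(x)\in f(\bar x)-(C\setminus\{0\})$; $\mathrm{WEff}(\Omega\mid f,C)$ is the set of $\bar x\in\Omega$ for which there is no $x\in\Omega$ with $f(x)\in f(\bar x)-\operatorname{int}C$; $\mathrm{PEff}_{He}(\Omega\mid f,K)$ is the set of $\bar x\in\Omega$ such that $\bar x\in\mathrm{Eff}(\Omega\mid f,D)$ for some $D\in\mathcal D(K)$. For a cone $M$: $B_M(\psi):=\{x\in M\mid\psi(x)=1\}$, $S_M(\psi):=\operatorname{conv}(B_M(\psi))$,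 $S^0_M(\psi):=\operatorname{conv}(\{0\}\cup B_M(\psi))$; $B_M(\psi)$ is a normlike-base for the nontrivial cone $M$ if $\psi>0$ on $M\setminus\{0\}$. $K^{a\#}(\psi):=\{(x^*,\alpha)\in Y^*\times\mathbb R_+\mid\forall y\in K\setminus\{0\}:\ x^*(y)-\alpha\psi(y)>0\}$. $C_\psi(x^*,\alpha):=\{y\in Y\mid x^*(y)\ge\alpha\psi(y)\}$, $C^>_\psi(x^*,\alpha):=\{y\in Y\mid x^*(y)>\alpha\psi(y)\}$, $\varphi_{x^*,\alpha}(y):=x^*(y)+\alpha\psi(y)$. $\varphi$ is $-C$ representing if $-C=\{y\in Y\mid\varphi(y)\le0\}$, and strictly $-C$ representing if in addition $-\operatorname{int}C=\{y\in Y\mid\varphi(y)<0\}$. $f[M]$ is the image of $M$. $(P_\varphi^{a,k})$ is the problem: minimize $\lambda$ subject to $\varphi(f(x)-a-\lambda k)\le0$, $(x,\lambda)\in\Omega\times\mathbb R$; a solution is a feasible pair with $\lambda$ minimal among all feasible pairs. $\varphi^G_{a-C,k}(y):=\inf\{t\in\mathbb R\mid y\in tk+(a-C)\}\in\mathbb R\cup\{\pm\infty\}$ ($\inf\emptyset=+\infty$). *)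

(* Defs.v *)
From HB Require Import structures.
From mathcomp Require Import all_boot all_order all_algebra.
From mathcomp Require Import all_classical all_reals all_analysis.
Set Implicit Arguments.
Unset Strict Implicit.
Unset Printing Implicit Defensive.
Import Order.TTheory GRing.Theory Num.Theory.
Import numFieldNormedType.Exports.
Local Open Scope classical_set_scope.
Local Open Scope ring_scope.

Section Cones.
Context {R : realType} {Y : tvsType R}.
Implicit Types (K D M C : set Y) (psi phi : Y -> R).

Definition is_cone K : Prop :=
  K 0 /\ K = [set t *: y | t in [set t : R | 0 <= t] & y in K].

Definition nontrivial K : Prop := K <> [set 0] /\ K <> setT.

(* The intersection of all convex sets that contain A. *)
Definition conv_hull (A : set Y) : set Y := smallest (@convex_set R Y) A.

Definition dilating_cones K : set (set Y) :=
  [set D | [/\ is_cone D, nontrivial D, convex_set D & K `\ 0 `<=` D°]].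

Definition neg_set (A : set Y) : set Y := [set - y | y in A].

Definition seminorm psi : Prop :=
  (forall y z, psi (y + z) <= psi y + psi z) /\
  (forall (t : R) y, psi (t *: y) = `|t| * psi y).

Definition base psi M : set Y := [set y | M y /\ psi y = 1].

Definition conv_base psi M : set Y := conv_hull (base psi M).

Definition conv_base0 psi M : set Y := conv_hull ([set 0] `|` base psi M).

(* "[base psi M] is a normlike-base for the nontrivial cone M": M being a
   nontrivial cone is part of the notion. *)
Definition normlike_base psi M : Prop :=
  [/\ is_cone M, nontrivial M & forall y, (M `\ 0) y -> 0 < psi y].

Definition topological_dual : set {linear Y -> R^o} :=
  [set xs | continuous (xs : Y -> R^o)].

(* The pairs (xs, alpha), with alpha >= 0, of the set usually written K^{a#}. *)
Definition augmented_dual psi K : set ({linear Y -> R^o} * R) :=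
  [set p | [/\ topological_dual p.1, 0 <= p.2 &
    forall y, (K `\ 0) y -> 0 < p.1 y - p.2 * psi y]].

Definition bp_cone psi (xs : {linear Y -> R^o}) (alpha : R) : set Y :=
  [set y | alpha * psi y <= xs y].

Definition bp_cone_gt psi (xs : {linear Y -> R^o}) (alpha : R) : set Y :=
  [set y | alpha * psi y < xs y].

Definition bp_fun psi (xs : {linear Y -> R^o}) (alpha : R) : Y -> R :=
  fun y => xs y + alpha * psi y.

Definition sublinear phi : Prop :=
  (forall y z, phi (y + z) <= phi y + phi z) /\
  (forall (t : R) y, 0 < t -> phi (t *: y) = t * phi y).

Definition neg_representing C phi : Prop :=
  neg_set C = [set y | phi y <= 0].

Definition strictly_neg_representing C phi : Prop :=
  neg_representing C phi /\ neg_set C° = [set y | phi y < 0].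

(* Applied to E = a - C this is the Gerstewitz functional, inf of the empty set
   being +oo. *)
Definition gerstewitz (E : set Y) (k y : Y) : \bar R :=
  ereal_inf [set t%:E | t in [set t : R | [set t *: k + v | v in E] y]].

End Cones.

Section VectorOptimization.
Context {R : realType} {X : topologicalLmodType R} {Y : tvsType R}.
Implicit Types (Omega : set X) (f : X -> Y) (C K : set Y).

Definition Eff Omega f C : set X :=
  [set xb | Omega xb /\
    ~ exists2 x, Omega x & [set f xb - c | c in C `\ 0] (f x)].

Definition WEff Omega f C : set X :=
  [set xb | Omega xb /\
    ~ exists2 x, Omega x & [set f xb - c | c in C°] (f x)].

(* Proper efficiency in the sense of Henig. *)
Definition PEff_He Omega f K : set X :=
  [set xb | Omega xb /\ exists2 D, dilating_cones K D & Eff Omega f D xb].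

Definition feasible Omega f (phi : Y -> R) (a k : Y) : set (X * R) :=
  [set p | Omega p.1 /\ phi (f p.1 - a - p.2 *: k) <= 0].

Definition solution Omega f (phi : Y -> R) (a k : Y) : set (X * R) :=
  [set p | feasible Omega f phi a k p /\
    forall q, feasible Omega f phi a k q -> p.2 <= q.2].

Definition argmin Omega (g : X -> R) : set X :=
  [set xb | Omega xb /\ forall x, Omega x -> g xb <= g x].

End VectorOptimization.

Definition is_min {R : realType} (A : set (\bar R)) (m : \bar R) : Prop :=
  A m /\ lbound A m.

(* Main.v *)
Require Import Defs.
From HB Require Import structures.
From mathcomp Require Import all_boot all_order all_algebra.
From mathcomp Require Import all_classical all_reals all_analysis.
From mathcomp Require Import lra.
Set Implicit Arguments.
Unset Strict Implicit.
Unset Printing Implicit Defensive.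
Import Order.TTheory GRing.Theory Num.Theory.
Import numFieldNormedType.Exports.
Local Open Scope classical_set_scope.
Local Open Scope ring_scope.

(* Separate the compact convex set [cl S_{-K}] strictly from [S^0_Dbar] by a
   continuous linear functional [xs] and a level [c].  Since 0 lies in the second
   set, c < 0, and [alpha := - c] works: scaling the two bases to arbitrary
   vectors gives xs > alpha psi on K \ 0 and xs > - alpha psi on Dbar \ 0, and
   the latter says C \ 0 <= int D, so efficiency for D implies weak efficiency
   for C.  Parts (i), (iii) and (iv) all rest on one fact: if f xb = a + s k with
   k in int C and f x lies in a + t k - C, then s <= t, for otherwise
   f x would lie in f xb - (C + (s - t) k), inside f xb - int C. *)

(** * Convexity in terms of real coefficients *)

Lemma convex_setP (R : realType) (Y : lmodType R) (A : set Y) :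
  convex_set (A : set (convex_lmodType Y)) <->
  forall x y (t : R), 0 <= t <= 1 -> A x -> A y -> A (t *: x + (1 - t) *: y).
Proof.
split=> [cA x y t t01 Ax Ay|cA x y l].
  pose l : {i01 R} := Itv01 (andP t01).1 (andP t01).2.
  by have := cA x y l (mem_set Ax) (mem_set Ay); rewrite inE.
by rewrite !inE => Ax Ay; apply: cA => //; rewrite ge0 le1.
Qed.

Lemma convex_conv_hull (R : realType) (Y : tvsType R) (A : set Y) :
  convex_set (conv_hull A : set (convex_lmodType Y)).
Proof.
apply/convex_setP => x y t t01 cx cy B [cB AB].
by apply: ((convex_setP B).1 cB) => //; [exact: cx|exact: cy].
Qed.

(** * Neighborhoods and interiors in topological vector spaces *)

Section Neighborhoods.
Context {R : realType} {Y : tvsType R}.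
Implicit Types (U C : set Y) (x y c k : Y).

Lemma nbhs_translate U x : nbhs x U -> nbhs 0 [set v | U (x + v)].
Proof.
move=> /(nbhsB (- x)); rewrite addNr.
by apply: filterS => _ [z Uz <-] /=; rewrite addNKr.
Qed.

(** Scaling is continuous at [(0, y)], so small multiples of [y] fall into the translate of [U] to
    the origin. *)
Lemma nbhs_absorbing U x y : nbhs x U -> exists2 d : R, 0 < d & U (x + d *: y).
Proof.
move=> /nbhs_translate Ux.
have := @scale_continuous R Y (0 : R^o, y) [set v | U (x + v)].
rewrite /= scale0r => /(_ Ux)[[A B]/= [A0 By] AB].
have /nbhs_ballP[e /= e0 eA] := A0.
exists (e / 2); first by rewrite divr_gt0.
apply: (AB (e / 2, y)); split => /=; last exact: nbhs_singleton.
apply: eA; rewrite /ball /= sub0r normrN gtr0_norm ?divr_gt0//.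
by rewrite ltr_pdivrMr// mulr_natr mulr2n ltrDl.
Qed.

(** The homeomorphism [x |-> c + t *: x] maps [C], a neighborhood of [k], into [C]. *)
Lemma convex_cone_interior C c k (t : R) :
  (forall x y, C x -> C y -> C (x + y)) ->
  (forall s x, 0 < s -> C x -> C (s *: x)) ->
  C c -> C° k -> 0 < t -> C° (c + t *: k).
Proof.
move=> addC scaleC Cc Ck t0.
have /(nbhsB c) := nbhsZ (lt0r_neq0 t0) Ck.
by apply: filterS => _ [_ [x Cx <-] <-]; apply: addC => //; exact: scaleC.
Qed.

End Neighborhoods.

(** * Separation of convex sets through maximal strict cones *)

Section PositiveFunctional.
Context {R : realType} {Y : tvsType R}.
Implicit Types (A W : set Y) (x y e : Y) (g : {linear Y -> R^o}).

(** The positive elements of a strict vector order, [x < y] meaning [A (y - x)]; the empty set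
    qualifies. *)
Definition strict_cone A : Prop :=
  [/\ forall x y, A x -> A y -> A (x + y),
      forall (t : R) x, 0 < t -> A x -> A (t *: x) & ~ A 0].

Lemma strict_cone_of_convex W :
  convex_set (W : set (convex_lmodType Y)) -> ~ W 0 ->
  strict_cone [set t *: w | t in [set t : R | 0 < t] & w in W].
Proof.
move=> /convex_setP cW W0; split.
- move=> _ _ [t /= t0 [w Ww <-]] [s /= s0 [w' Ww' <-]].
  have ts0 : 0 < t + s by rewrite addr_gt0.
  exists (t + s) => //; exists ((t / (t + s)) *: w + (1 - t / (t + s)) *: w').
    apply: cW => //; apply/andP; split; first by rewrite divr_ge0// ltW.
    by rewrite ler_pdivrMr// mul1r lerDl ltW.
  rewrite scalerDr !scalerA mulrBr mulr1 mulrC divfK ?gt_eqF//.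
  by rewrite addrAC subrr add0r.
- move=> t _ t0 [s /= s0 [w Ww <-]].
  by exists (t * s); [rewrite /= mulr_gt0|exists w => //; rewrite scalerA].
- move=> [t /= t0 [w Ww /eqP]]; rewrite scaler_eq0 gt_eqF//= => /eqP w0.
  by rewrite w0 in Ww.
Qed.

(* Adjoining the ray of [y] to a maximal strict cone gives either the same cone,
   or a set containing 0, which means that [- y] was in the cone already. *)
Lemma maximal_strict_cone W : W !=set0 ->
  convex_set (W : set (convex_lmodType Y)) -> ~ W 0 ->
  exists A, [/\ W `<=` A, strict_cone A &
    forall y, ~ A (- y) -> forall a, A a -> A (y + a)].
Proof.
move=> [w0 Ww0] cW W0.
(* Zorn's lemma also asks about the empty chain, whose union is empty; hence [W] has to lie in [A]
   only when [A] is nonempty. *)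
pose P A := strict_cone A /\ (A !=set0 -> W `<=` A).
have [F FP totF|A [[[addA scaleA A0] WA] maxA]] := @Zorn_bigcup Y P.
  split; last first.
    move=> [x [A FA Ax]] w Ww; exists A => //.
    by apply: (FP A FA).2 => //; exists x.
  split.
  - move=> x y [A FA Ax] [B FB By].
    have [AB|BA] := totF _ _ FA FB.
      by exists B => //; have [[+ _ _] _] := FP _ FB; apply => //; exact: AB.
    by exists A => //; have [[+ _ _] _] := FP _ FA; apply => //; exact: BA.
  - move=> t x t0 [A FA Ax]; exists A => //.
    by have [[_ + _] _] := FP _ FA; exact.
  - by move=> [A FA]; have [[_ _ +] _] := FP _ FA.
have maxA' B : P B -> A `<=` B -> B `<=` A.
  by move=> PB AB; apply: contrapT => BA; exact: (maxA B).
have {}WA : W `<=` A.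
  (* Were the maximal [A] empty, the cone generated by [W] would extend it. *)
  have [A_0|/set0P/WA //] := eqVneq A set0.
  pose B := [set t *: w | t in [set t : R | 0 < t] & w in W].
  have WB : W `<=` B.
    by move=> w Ww; exists 1 => //=; exists w => //; rewrite scale1r.
  have BA : B `<=` A.
    by apply: maxA'; [split => //; exact: strict_cone_of_convex|rewrite A_0].
  exact: subset_trans WB BA.
exists A; split => // y Ay a Aa.
pose B : set Y := [set z | exists2 t : R, 0 <= t & A (z - t *: y)].
have AB : A `<=` B by move=> z Az; exists 0 => //; rewrite scale0r subr0.
have BA : B `<=` A.
  apply: maxA' => //; split; last by move=> _; exact: subset_trans WA AB.
  split.
  - move=> u v [t t0 Au] [s s0 Av]; exists (t + s); first by rewrite addr_ge0.
    by rewrite scalerDl opprD addrACA; exact: addA.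
  - move=> t u t0 [s s0 Au]; exists (t * s); first by rewrite mulr_ge0// ltW.
    by rewrite -scalerA -scalerBr; exact: scaleA.
  - move=> [t]; rewrite le_eqVlt sub0r => /predU1P[<-|t0].
      by rewrite scale0r oppr0.
    move=> /(scaleA t^-1); rewrite invr_gt0 => /(_ t0).
    by rewrite scalerN scalerA mulVf ?gt_eqF// scale1r.
by apply: BA; exists 1 => //; rewrite scale1r addrAC subrr add0r.
Qed.

(** By homogeneity [g] is at most [e / 2] in absolute value on [(e / 2) U], and additivity carries
    this estimate to any point [x]. *)
Lemma linear_continuous_of_bounded g U : nbhs 0 U ->
  (forall v, U v -> `|g v| <= 1) -> continuous (g : Y -> R^o).
Proof.
move=> U0 gU x; apply/cvgrPdist_lt => e e0.
have /(nbhsT x) : nbhs 0 ( *:%R (e / 2) @` U).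
  by apply: nbhs0Z => //; rewrite gt_eqF// divr_gt0.
apply: filterS => _ [_ [v Uv <-] <-].
rewrite linearD linearZ/= opprD addNKr normrN normrM gtr0_norm ?divr_gt0//.
rewrite (le_lt_trans (ler_wpM2l _ (gU _ Uv))) ?mulr1 ?divr_ge0 ?ltW//.
by rewrite ltr_pdivrMr// mulr_natr mulr2n ltrDl.
Qed.

(* A maximal strict cone [A] is a total order up to infinitesimals, for which
   [e] is an order unit; hence [y |-> sup {t | t e < y}] is odd as well as
   superadditive. *)
Lemma positive_functional W e :
  convex_set (W : set (convex_lmodType Y)) -> ~ W 0 -> nbhs e W ->
  exists g, [/\ continuous (g : Y -> R^o), g e = 1 & forall w, W w -> 0 <= g w].
Proof.
move=> cW W0 We.
have We1 := nbhs_singleton We.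
have [A [WA [addA scaleA A0] totA]] :=
  maximal_strict_cone (ex_intro _ e We1) cW W0.
have Ae := WA _ We1.
pose S y : set R := [set t | A (y - t *: e)].
(* [W] is a neighborhood of [e], so [e + d y] lies in [A] for some [d > 0]; dividing by [d] shows
   that [- d^-1] is in [S y]. *)
have S_nonempty y : exists t, S y t.
  have [d d0 /WA] := nbhs_absorbing y We.
  move=> /(scaleA d^-1); rewrite invr_gt0 => /(_ d0).
  rewrite scalerDr scalerA mulVf ?gt_eqF// scale1r => Ay.
  by exists (- d^-1); rewrite /S /= scaleNr opprK addrC.
(* Otherwise [- (t + s) e] is in [A], and adding [(t + s) e] puts 0 into [A]. *)
have S_bound y t s : S y t -> S (- y) s -> t + s < 0.
  move=> Syt Sys; rewrite ltNge; apply/negP => ts0.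
  have := addA _ _ Syt Sys; rewrite addrACA subrr add0r -opprD -scalerDl.
  move: ts0; rewrite le_eqVlt => /predU1P[<-|ts0]; first by rewrite scale0r oppr0.
  by move=> /(addA _ _ (scaleA _ _ ts0 Ae)); rewrite subrr.
have S_sup y : has_sup (S y).
  split; first exact: S_nonempty.
  have [s Ss] := S_nonempty (- y); exists (- s) => t /S_bound /(_ Ss).
  by rewrite -ltrBrDr sub0r => /ltW.
pose g y := sup (S y).
have g_ge y t : A (y - t *: e) -> t <= g y by move=> ?; exact: sup_upper_bound.
have lt_g y t : t < g y -> A (y - t *: e).
  move=> tg; have [s Ss ts] := sup_gt (S_nonempty y) tg.
  have st : 0 < s - t by rewrite subr_gt0.
  have := addA _ _ Ss (scaleA _ _ st Ae).
  by rewrite scalerBl addrA subrK.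
have g_superadd y z : g y + g z <= g (y + z).
  apply/ler_addgt0Pr => d d0.
  have d2 : 0 < d / 2 by rewrite divr_gt0.
  have ly : g y - d / 2 < g y by rewrite ltrBlDr ltrDl.
  have lz : g z - d / 2 < g z by rewrite ltrBlDr ltrDl.
  have := addA _ _ (lt_g _ _ ly) (lt_g _ _ lz).
  rewrite addrACA -opprD -scalerDl => /g_ge; lra.
(* [y] is not above [(g y + d / 2) e], so by [totA] adding [(d / 2) e] to [(g y + d / 2) e - y]
   gives an element of [A]; that is, [- (g y + d)] belongs to [S (- y)]. *)
have gN_ge y : - g y <= g (- y).
  apply/ler_addgt0Pr => d d0.
  have d2 : 0 < d / 2 by rewrite divr_gt0.
  have : ~ A (- ((g y + d / 2) *: e - y)).
    by rewrite opprB => /g_ge; rewrite gerDl leNgt d2.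
  move=> /totA /(_ _ (scaleA _ _ d2 Ae)).
  rewrite (_ : _ + _ = - y - (- (g y + d)) *: e); last first.
    rewrite addrAC -scalerDl addrC scaleNr opprK -addrA; congr (_ + _ *: _); lra.
  move=> /g_ge; lra.
have g0 : g 0 = 0.
  by apply/eqP; rewrite eq_le; have := g_superadd 0 0; have := gN_ge 0;
     rewrite oppr0 addr0; lra.
have gN y : g (- y) = - g y.
  apply/eqP; rewrite eq_le gN_ge andbT.
  by have := g_superadd y (- y); rewrite subrr g0; lra.
have gD y z : g (y + z) = g y + g z.
  apply/eqP; rewrite eq_le g_superadd andbT.
  by have := g_superadd (y + z) (- z); rewrite addrK gN; lra.
have gZ_ge t y : 0 < t -> t * g y <= g (t *: y).
  move=> t0; apply/ler_addgt0Pr => d d0.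
  have ly : g y - d / t < g y by rewrite ltrBlDr ltrDl divr_gt0.
  have := scaleA _ _ t0 (lt_g _ _ ly).
  rewrite scalerBr scalerA => /g_ge.
  by rewrite mulrBr mulrCA divff ?gt_eqF// mulr1; lra.
have gZ_pos t y : 0 < t -> g (t *: y) = t * g y.
  move=> t0; apply/eqP; rewrite eq_le gZ_ge// andbT.
  have t'0 : 0 < t^-1 by rewrite invr_gt0.
  have := gZ_ge _ (t *: y) t'0.
  by rewrite scalerA mulVf ?gt_eqF// scale1r mulrC ler_pdivrMr// mulrC.
have gZ t y : g (t *: y) = t * g y.
  have [t0|t0|->] := ltgtP t 0; last by rewrite scale0r g0 mul0r.
    by rewrite -[t]opprK scaleNr gN gZ_pos ?oppr_gt0// !mulNr.
  exact: gZ_pos.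
have g_lin : linear (g : Y -> R^o) by move=> t y z; rewrite gD gZ.
pose gl : {linear Y -> R^o} :=
  HB.pack (g : Y -> R^o) (GRing.isLinear.Build R Y R^o *:%R g g_lin).
have gA w : A w -> 0 <= g w by move=> Aw; apply: g_ge; rewrite scale0r subr0.
have ge1 : g e = 1.
  apply/eqP; rewrite eq_le; apply/andP; split; last first.
    apply/ler_addgt0Pr => d d0; rewrite -lerBlDr; apply: g_ge.
    by rewrite scalerBl scale1r opprB addrC subrK; exact: scaleA.
  rewrite leNgt; apply/negP => /lt_g.
  by rewrite scale1r subrr.
exists gl; split => //; last by move=> w /WA /gA.
(* On this symmetric neighborhood both [e + v] and [e - v] lie in [W], where [g] is nonnegative;
   since [g e = 1], this bounds [g v] by 1 in absolute value. *)
have We0 := nbhs_translate We.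
apply: (linear_continuous_of_bounded (filterI We0 (nbhs0N We0))).
move=> v [Wv [u Wu uv]].
rewrite ler_norml; apply/andP; split.
  by have := gA _ (WA _ Wv); rewrite gD ge1 => ?; rewrite /=; lra.
have := gA _ (WA _ Wu); rewrite gD ge1 -uv => ?; rewrite /= gN; lra.
Qed.

(** Compactness gives a convex neighborhood [V] of 0 with [B + V] disjoint from [A]. Then
    [W = A - B - V] is convex, misses 0 and is a neighborhood of [a0 - b0], so [positive_functional]
    applies; the room left by [V] makes the inequality strict and uniform. *)
Lemma strong_separation A B : A !=set0 -> B !=set0 ->
  convex_set (A : set (convex_lmodType Y)) ->
  convex_set (B : set (convex_lmodType Y)) ->
  compact (closure B) -> closure A `&` closure B = set0 ->
  exists g (c : R), [/\ continuous (g : Y -> R^o), forall a, A a -> c < g a &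
    forall b, B b -> g b < c].
Proof.
move=> [a0 Aa0] [b0 Bb0] /convex_setP cA /convex_setP cB cpB AB.
(* Each [b] in [closure B] has a neighborhood whose small translates avoid [closure A]; compactness
   makes the size of the translation uniform. *)
have : \forall v \near (0 : Y), closure B `<=` [set b | ~ A (b + v)].
  move/compact_near_coveringP : cpB; apply => b clBb.
  have nAb : nbhs b (~` closure A).
    apply: open_nbhs_nbhs; split.
      by apply: closed_openC; exact: closed_closure.
    by move=> clAb; rewrite -[False]/(set0 b) -AB.
  have := @add_continuous Y (b, 0) (~` closure A); rewrite /= addr0 => /(_ nAb).
  move=> [[U V]/= [Ub V0] UV]; exists (U, V) => //= -[b' v] [/= Ub' Vv] Abv.
  by apply: (UV (b', v)) => //; exact: subset_closure.
have [BB cBB [opBB basisBB]] := @locally_convex R Y.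
move=> /basisBB[V [BBV V0] VB].
have /convex_setP cV := cBB _ (mem_set BBV).
pose W : set Y := [set w | exists a b, [/\ A a, B b & V (a - b - w)]].
have cW : convex_set (W : set (convex_lmodType Y)).
  apply/convex_setP => x y t t01 [a [b [Aa Bb Vx]]] [a' [b' [Aa' Bb' Vy]]].
  exists (t *: a + (1 - t) *: a'), (t *: b + (1 - t) *: b').
  split; [exact: cA|exact: cB|].
  rewrite (_ : _ - _ - _ = t *: (a - b - x) + (1 - t) *: (a' - b' - y)).
    exact: cV.
  by rewrite !scalerBr !opprD [X in X + _ = _]addrACA [LHS]addrACA.
have W0 : ~ W 0.
  move=> [a [b [Aa Bb]]]; rewrite subr0 => /VB /(_ b (subset_closure Bb)) /=.
  by rewrite subrKC.
have We : nbhs (a0 - b0) W.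
  have : nbhs 0 V by apply: open_nbhs_nbhs; split => //; exact: opBB.
  move=> /nbhs0N /(nbhsT (a0 - b0)); apply: filterS => _ [_ [v Vv <-] <-].
  by exists a0, b0; split => //; rewrite opprD opprK addNKr.
have [g [cg ge gW]] := positive_functional cW W0 We.
(* [g] takes the value [d] at [d (a0 - b0)], a point of [V]; this is the width of the gap, and the
   level [c] is put in its middle. *)
have [d d0] : exists2 d : R, 0 < d & V (0 + d *: (a0 - b0)).
  by apply: nbhs_absorbing; apply: open_nbhs_nbhs; split => //; exact: opBB.
rewrite add0r => Vd.
have gap a b : A a -> B b -> g b + d <= g a.
  move=> Aa Bb; have : W (a - b - d *: (a0 - b0)).
    by exists a, b; split => //; rewrite opprB subrKC.
  by move=> /gW; rewrite linearB linearZ/= ge linearB /GRing.scale/=; lra.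
pose s := sup (g @` B).
have supB : has_sup (g @` B).
  split; first by exists (g b0); exists b0.
  by exists (g a0) => _ [b Bb <-]; have := gap _ _ Aa0 Bb; lra.
exists g, (s + d / 2); split => //.
- move=> a Aa; have : s <= g a - d.
    apply: sup_le_ub; first by exists (g b0); exists b0.
    by move=> _ [b Bb <-]; have := gap _ _ Aa Bb; lra.
  lra.
- move=> b Bb; have : g b <= s by apply: sup_upper_bound => //; exists b.
  lra.
Qed.

End PositiveFunctional.

(** * Bishop-Phelps cones and the functionals representing them *)

Section BishopPhelpsCone.
Context {R : realType} {Y : tvsType R}.
Variables (psi : Y -> R) (xs : {linear Y -> R^o}) (alpha : R).
Hypotheses (psi_seminorm : seminorm psi) (alpha_ge0 : 0 <= alpha).
Implicit Types (y z : Y) (t : R).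
Local Notation C := (bp_cone psi xs alpha).
Local Notation Cgt := (bp_cone_gt psi xs alpha).

Lemma seminorm0 : psi 0 = 0.
Proof. by rewrite -(scale0r 0) psi_seminorm.2 normr0 mul0r. Qed.

Lemma seminormN y : psi (- y) = psi y.
Proof. by rewrite -scaleN1r psi_seminorm.2 normrN normr1 mul1r. Qed.

Lemma bp_coneD y z : C y -> C z -> C (y + z).
Proof.
rewrite /bp_cone /= => Cy Cz; rewrite linearD/=.
rewrite (le_trans (ler_wpM2l alpha_ge0 (psi_seminorm.1 y z)))//.
by rewrite mulrDr lerD.
Qed.

Lemma bp_coneZ t y : 0 < t -> C y -> C (t *: y).
Proof.
rewrite /bp_cone /= => t0 Cy; rewrite linearZ/= psi_seminorm.2 gtr0_norm//.
by rewrite mulrCA /GRing.scale/= ler_wpM2l// ltW.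
Qed.

Lemma bp_fun_sublinear : sublinear (bp_fun psi xs alpha).
Proof.
split=> [y z|t y t0]; rewrite /bp_fun.
  by rewrite linearD addrACA/= lerD2l -mulrDr ler_wpM2l// psi_seminorm.1.
by rewrite linearZ/= psi_seminorm.2 gtr0_norm// mulrDr mulrCA.
Qed.

Hypotheses (psi_cont : continuous psi) (xs_cont : continuous (xs : Y -> R^o)).

(** From an interior point [y] one can step back to [y - d e] inside [C], with [e] in [Cgt];
    returning by [d e] gains strictness. Conversely, [Cgt] is open by continuity of [xs] and
    [psi]. *)
Lemma bp_cone_interior : Cgt !=set0 -> C° = Cgt.
Proof.
move=> [e Cgte]; apply/seteqP; split => y.
  move=> Cy; have [d d0] := nbhs_absorbing (- e) Cy; rewrite scalerN => Cyde.
  have {}Cyde : alpha * psi (y - d *: e) <= xs y - d * xs e.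
    by rewrite (le_trans Cyde)// linearB linearZ.
  have := psi_seminorm.1 (y - d *: e) (d *: e).
  rewrite subrK psi_seminorm.2 gtr0_norm// => /(ler_wpM2l alpha_ge0).
  have : 0 < d * (xs e - alpha * psi e) by rewrite mulr_gt0// subr_gt0.
  by rewrite mulrBr mulrCA mulrDr /bp_cone_gt/=; lra.
suff opC : open Cgt.
  by have : Cgt `<=` C°; [rewrite -open_subsetE// => z /ltW|exact].
rewrite (_ : Cgt = (fun y => xs y - alpha * psi y) @^-1` [set r | 0 < r]).
  apply: open_comp; last exact: open_gt.
  move=> y' _; apply: cvgB; first exact: xs_cont.
  by apply: cvgM; [exact: cvg_cst|exact: psi_cont].
by apply/seteqP; split => z /=; rewrite subr_gt0.
Qed.

Lemma bp_fun_strictly_representing : Cgt !=set0 ->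
  strictly_neg_representing C (bp_fun psi xs alpha).
Proof.
move=> /bp_cone_interior CE; split; rewrite ?CE; apply/seteqP; split => y.
- by move=> [z Cz <-]; rewrite /bp_fun /= linearN/= seminormN addrC subr_le0.
- move=> /= le0; exists (- y); rewrite ?opprK//.
  by rewrite /bp_cone /= linearN/= seminormN; move: le0; rewrite /bp_fun; lra.
- by move=> [z Cz <-]; rewrite /bp_fun /= linearN/= seminormN addrC subr_lt0.
- move=> /= lt0; exists (- y); rewrite ?opprK//.
  by rewrite /bp_cone_gt /= linearN/= seminormN; move: lt0; rewrite /bp_fun; lra.
Qed.

End BishopPhelpsCone.

(** * Scalarization at a weakly efficient point *)

Section WeakEfficiency.
Context {R : realType} {X : topologicalLmodType R} {Y : tvsType R}.
Variables (Omega : set X) (f : X -> Y) (C : set Y) (xb : X).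
Hypotheses (addC : forall x y, C x -> C y -> C (x + y))
  (scaleC : forall (t : R) x, 0 < t -> C x -> C (t *: x))
  (C0 : C 0) (xb_WEff : WEff Omega f C xb).
Implicit Types (a k c : Y) (s t : R).

Lemma WEff_level_le a k s t x c : C° k -> f xb = a + s *: k -> Omega x -> C c ->
  f x = a + t *: k - c -> s <= t.
Proof.
move=> Ck fxb Ox Cc fx; rewrite leNgt; apply/negP => ts.
apply: xb_WEff.2; exists x => //; exists (c + (s - t) *: k).
  by apply: convex_cone_interior => //; rewrite subr_gt0.
by rewrite fx fxb scalerBl opprD opprB addrACA subrKC addrAC.
Qed.

(** Since [phi] represents [- C], a pair [(x, t)] with [x] in [Omega] is feasible exactly when [f x]
    lies in [a + t k - C], which [WEff_level_le] bounds. *)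
Lemma WEff_solution (phi : Y -> R) a k s : phi 0 = 0 -> neg_representing C phi ->
  C° k -> f xb = a + s *: k -> solution Omega f phi a k (xb, s).
Proof.
move=> phi0 Cphi Ck fxb; split.
  split => /=; first exact: xb_WEff.1.
  by rewrite /= fxb addrAC addrK subrr phi0.
move=> [x t] [/= Ox phi_le].
have : neg_set C (f x - a - t *: k) by rewrite Cphi.
move=> [c Cc cE]; apply: (WEff_level_le Ck fxb Ox Cc).
by rewrite cE -[_ - a - _]addrA -opprD subrKC.
Qed.

(** [WEff_level_le] makes [s] a lower bound of the level set of every [f x]; [C 0] puts [s] itself
    into that of [f xb]. *)
Lemma WEff_gerstewitz a k s : C° k -> f xb = a + s *: k ->
  s%:E = gerstewitz [set a - c | c in C] k (f xb) /\
  is_min [set gerstewitz [set a - c | c in C] k (f x) | x in Omega] s%:E.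
Proof.
move=> Ck fxb.
have s_le x : Omega x -> (s%:E <= gerstewitz [set (a - c)%R | c in C] k (f x))%E.
  move=> Ox; apply/ereal_infP => _ [t [_ [c Cc <-] fx] <-].
  by rewrite lee_fin; apply: (WEff_level_le Ck fxb Ox Cc); rewrite -fx addrCA addrA.
have sE : s%:E = gerstewitz [set a - c | c in C] k (f xb).
  apply/eqP; rewrite eq_le (s_le _ xb_WEff.1)/=.
  apply: ereal_inf_lbound; exists s => //; exists a; last by rewrite fxb addrC.
  by exists 0 => //; rewrite subr0.
split => //; split; first by exists xb => //; exact: xb_WEff.1.
by move=> _ [x Ox <-]; exact: s_le.
Qed.

End WeakEfficiency.

(** * Construction of the augmented functional and the scalarization results *)

Theorem theorem38 (R : realType) (X : topologicalLmodType R) (Y : tvsType R)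
    (Omega : set X) (Omega_neq0 : Omega !=set0) (f : X -> Y)
    (K : set Y) (cone_K : is_cone K) (nontrivial_K : nontrivial K)
    (xb : X) (xb_PEff : PEff_He Omega f K xb)
    (D : set Y) (D_dilating : dilating_cones K D) (xb_Eff : Eff Omega f D xb)
    (Dbar : set Y) (Dbar_def : Dbar = ~` neg_set D°)
    (psi : Y -> R) (psi_seminorm : seminorm psi) (psi_cont : continuous psi)
    (base_K : normlike_base psi K) (base_Dbar : normlike_base psi Dbar)
    (compact_S : compact (closure (conv_base psi (neg_set K))))
    (disj : closure (conv_base0 psi Dbar)
            `&` closure (conv_base psi (neg_set K)) = set0) :
  exists (xs : {linear Y -> R^o}) (alpha : R),
    (augmented_dual psi K
       `&` (topological_dual `*` [set t : R | 0 < t])) (xs, alpha) /\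
    let C := bp_cone psi xs alpha in
    [/\ WEff Omega f C xb,
        (* the example given in (ii) *)
        bp_cone_gt psi xs alpha !=set0 ->
          [/\ sublinear (bp_fun psi xs alpha), bp_fun psi xs alpha 0 = 0 &
              strictly_neg_representing C (bp_fun psi xs alpha)]
      & C° !=set0 ->
        forall phi : Y -> R,
          sublinear phi -> phi 0 = 0 -> neg_representing C phi ->
        [/\ (* (i) *)
            forall k, C° k -> solution Omega f phi (f xb) k (xb, 0),
            (* (ii) *)
            strictly_neg_representing C phi ->
              argmin Omega (fun x => phi (f x - f xb)) xb,
            (* (iii) *)
            forall (P T : set Y) (S : set R), T `<=` C° ->
              f @` WEff Omega f C
                `<=` [set a + v | a in P & v in [set s *: k | s in S & k in T]] ->
              exists a k s, [/\ P a, T k, S s & solution Omega f phi a k (xb, s)]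
          & (* (iv) *)
            forall (P T : set Y) (S : set R), T `<=` C° ->
              f @` WEff Omega f C
                `<=` [set a + v | a in P & v in [set s *: k | s in S & k in T]] ->
              closed C -> nontrivial C ->
              exists a k s, [/\ P a, T k, S s,
                s%:E = gerstewitz [set a - c | c in C] k (f xb) &
                is_min [set gerstewitz [set a - c | c in C] k (f x)
                         | x in Omega] s%:E]]].
Proof.
have [K0 KE] := cone_K.
have [[_ DbarE] _ Dbar_pos] := base_Dbar.
have [_ _ K_pos] := base_K.
have [[D0 _] [_ DT] _ _] := D_dilating.
have scaleK (t : R) y : 0 <= t -> K y -> K (t *: y).
  by move=> t0 Ky; rewrite KE; exists t => //; exists y.
have scaleDbar (t : R) y : 0 <= t -> Dbar y -> Dbar (t *: y).
  by move=> t0 Dy; rewrite DbarE; exists t => //; exists y.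
have [k0 Kk0] : K `\ 0 !=set0.
  apply/set0P/eqP => K_0; apply: nontrivial_K.1.
  apply/seteqP; split => [y Ky /=|_ -> //].
  by apply: contrapT => y0; have : (K `\ 0) y by []; rewrite K_0.
have normalize y : 0 < psi y -> psi ((psi y)^-1 *: y) = 1.
  move=> y0; rewrite psi_seminorm.2 gtr0_norm ?invr_gt0//.
  by rewrite mulVf// gt_eqF.
have base_nK y : (K `\ 0) y -> conv_base psi (neg_set K) (- ((psi y)^-1 *: y)).
  move=> Ky; apply: sub_gen_smallest; split.
    exists ((psi y)^-1 *: y) => //.
    by apply: scaleK; [rewrite invr_ge0 ltW// K_pos|exact: Ky.1].
  by rewrite seminormN// normalize// K_pos.
have [xs [c [xs_cont xs_Dbar xs_K]]] := @strong_separation R Y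
  (conv_base0 psi Dbar) (conv_base psi (neg_set K))
  (ex_intro _ 0 (sub_gen_smallest (or_introl erefl)))
  (ex_intro _ _ (base_nK _ Kk0))
  (@convex_conv_hull _ _ _) (@convex_conv_hull _ _ _) compact_S disj.
have c_lt0 : c < 0.
  by rewrite -(linear0 xs); apply: xs_Dbar; apply: sub_gen_smallest; left.
have xs_gt y : (K `\ 0) y -> - c * psi y < xs y.
  move=> Ky; have := xs_K _ (base_nK _ Ky).
  have psiy := K_pos _ Ky.
  rewrite linearN/= linearZ/= /GRing.scale/= ltrNl mulrC.
  by rewrite ltr_pdivlMr.
have alpha_ge0 : 0 <= - c by rewrite oppr_ge0 ltW.
exists xs, (- c); split.
  split; last by split => //=; rewrite oppr_gt0.
  by split => //= y /xs_gt; rewrite subr_gt0.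
move=> C.
have C0 : C 0 by rewrite /C /bp_cone /= seminorm0// mulr0 linear0.
have addC := @bp_coneD _ _ _ xs _ psi_seminorm alpha_ge0.
have scaleC := @bp_coneZ _ _ _ xs (- c) psi_seminorm.
(* If [y] is not in the interior of [D], then [- y] is in [Dbar]; normalizing it by [psi] and
   separating gives [xs y < - c * psi y], against [C y]. *)
have C_sub y : C y -> y <> 0 -> D° y.
  move=> Cy y0; apply: contrapT => Dy.
  have Dbar_y : (Dbar `\ 0) (- y).
    split; last by move/eqP; rewrite oppr_eq0 => /eqP.
    by rewrite Dbar_def => -[z Dz /oppr_inj zy]; rewrite zy in Dz.
  have psiy := Dbar_pos _ Dbar_y.
  have : c < xs ((psi (- y))^-1 *: - y).
    apply: xs_Dbar; apply: sub_gen_smallest; right; split; last exact: normalize.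
    by apply: scaleDbar; [rewrite invr_ge0 ltW|exact: Dbar_y.1].
  rewrite linearZ/= linearN/= /GRing.scale/= mulrC ltr_pdivlMr// ltrNr -mulNr.
  by rewrite seminormN// ltNge; apply/negP/negPn; exact: Cy.
(* If 0 were interior to [C], some [- d k0] with [d > 0] would be in [C], although [xs] is positive
   at [d k0]. This matters because [Eff] excludes only nonzero differences. *)
have int_neq0 y : C° y -> y <> 0.
  move=> Cy y0; rewrite y0 in Cy; have [d d0] := nbhs_absorbing (- k0) Cy.
  rewrite add0r scalerN => Cdk.
  have {}Cdk : - c * psi (- (d *: k0)) <= xs (- (d *: k0)) by [].
  have dk0 : (K `\ 0) (d *: k0).
    split; first by apply: scaleK; [exact: ltW|exact: Kk0.1].
    by move/eqP; rewrite scaler_eq0 gt_eqF//= => /eqP; exact: Kk0.2.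
  move: Cdk; rewrite linearN/= seminormN//.
  have := xs_gt _ dk0; have := mulr_ge0 alpha_ge0 (ltW (K_pos _ dk0)); lra.
have WEff_xb : WEff Omega f C xb.
  split; first exact: xb_Eff.1.
  move=> [x Ox [y Cy fx]]; apply: xb_Eff.2; exists x => //; exists y => //.
  have y0 := int_neq0 _ Cy; split => //.
  by apply: interior_subset; apply: C_sub => //; exact: interior_subset.
split => //.
  move=> Cgt; split; first exact: bp_fun_sublinear.
    by rewrite /bp_fun linear0 add0r seminorm0 ?mulr0.
  exact: bp_fun_strictly_representing.
move=> _ phi _ phi0 Cphi.
have fxb k : f xb = f xb + 0 *: k by rewrite scale0r addr0.
split.
- by move=> k Ck; exact: (WEff_solution addC scaleC WEff_xb phi0 Cphi Ck (fxb k)).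
(* A negative value of [phi (f x - f xb)] would put [f x] in [f xb] minus the interior of [C]. *)
- move=> [_ intCphi]; split; first exact: xb_Eff.1.
  move=> x Ox; rewrite subrr phi0 leNgt; apply/negP => lt0.
  have [y Cy yE] : neg_set C° (f x - f xb) by rewrite intCphi.
  by apply: WEff_xb.2; exists x => //; exists y => //; rewrite yE subrKC.
(* The inclusion, applied to [f xb] itself, supplies the decomposition [f xb = a + s k]. *)
- move=> P T S TC fWEff.
  have [a Pa [_ [s Ss [k Tk <-]] axb]] := fWEff _ (imageP f WEff_xb).
  exists a, k, s; split => //.
  exact: (WEff_solution addC scaleC WEff_xb phi0 Cphi (TC _ Tk) (esym axb)).
- move=> P T S TC fWEff _ _.
  have [a Pa [_ [s Ss [k Tk <-]] axb]] := fWEff _ (imageP f WEff_xb).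
  have [sE s_min] := WEff_gerstewitz addC scaleC C0 WEff_xb (TC _ Tk) (esym axb).
  by exists a, k, s; split.
Qed.
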